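(* The adjunction $\mathcal O \dashv \mathsf{Spec}$ between the category $\mathbf{Top}$ of topological spaces and $\mathbf{Loc} = \mathbf{Frm}^{op}$ restricts to an adjoint equivalence between the full subcategory of $\mathbf{Top}$ consisting of the locally strongly sober spaces and the full subcategory of $\mathbf{Loc}$ consisting of the locally temperate spatial frames. It also restricts to an adjoint equivalence between the full subcategory of $\mathbf{Top}$ consisting of the strongly sober spaces and the full subcategory of $\mathbf{Loc}$ consisting of the temperate spatial frames.
   Context: For an ultrafilter $\mathcal U$ of subsets of a space $X$, $\lim \mathcal U$ is the set of points $x$ all of whose open neighborhoods are in $\mathcal U$. The space $X$ is locally strongly sober (resp. strongly sober) iff for every ultrafilter $\mathcal U$ on $X$, $\lim\mathcal U$ is either empty or the closure of a unique point (resp. is the closure of a unique point). A frame is a complete lattice $L$ such that $u \wedge \bigvee_{i \in I} v_i = \bigvee_{i \in I} (u \wedge v_i)$ for all $u, v_i \in L$; frame morphisms preserve all suprema and all finite infima; $\mathbf{Frm}$ is the category of frames and $\mathbf{Loc} = \mathbf{Frm}^{op}$. The functor $\mathcal O \colon \mathbf{Top} \to \mathbf{Loc}$ maps $X$ to its frame $\mathcal O X$ of open subsets ordered by inclusion, and a continuous map $f \colon X \to Y$ to $V \mapsto f^{-1}(V)$. For a frame $L$, $\mathsf{Spec}\, L$ is the space whose points are the completely prime filters of $L$ (filters $\Phi$ such that $\bigvee_{i\in I} u_i \in \Phi$ implies $u_i \in \Phi$ for some $i \in I$), with open subsets $\mathcal O_u = \{x \in \mathsf{Spec}\, L \mid u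 \in x\}$, $u \in L$; for a frame morphism $\varphi \colon L \to M$, $\mathsf{Spec}\, \varphi \colon \mathsf{Spec}\, M \to \mathsf{Spec}\, L$ maps $y$ to $\varphi^{-1}(y)$. The functor $\mathcal O$ is left adjoint to $\mathsf{Spec}$, and this adjunction restricts to an equivalence between sober spaces and spatial frames. A frame is spatial iff it is isomorphic to $\mathcal O X$ for some space $X$. A filter on $L$ is an upwards-closed, (non-empty) filtered subset. For filters $\mathcal F, \mathcal G$ on $L$, the join is the filter $\mathcal F \vee \mathcal G = \{u \wedge v \mid u \in \mathcal F, v \in \mathcal G\}$. A subset of $L$ is Scott-open iff it is upwards-closed and whenever it contains the supremum of a directed family, it contains some element of the family. A frame $L$ is locally temperate iff the join $\mathcal F \vee \mathcal G$ of any two Scott-open filters on $L$ is Scott-open. It is temperate iff it is locally temperate and the filter $\{\top\}$ (where $\top$ is the largest element of $L$) is Scott-open. *)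

(* Defs.v *)
From HB Require Import structures.
From mathcomp Require Import all_boot all_order.
From mathcomp Require Import boolp classical_sets filter topology_structure.

Set Implicit Arguments.
Unset Strict Implicit.
Unset Printing Implicit Defensive.
Import Order.TTheory.
Local Open Scope classical_set_scope.

Record category := Category {
  obj :> Type;
  hom : obj -> obj -> Type;
  idm : forall X, hom X X;
  compose : forall X Y Z, hom Y Z -> hom X Y -> hom X Z;
  compose1m : forall X Y (f : hom X Y), compose (idm Y) f = f;
  composem1 : forall X Y (f : hom X Y), compose f (idm X) = f;
  composeA : forall X Y Z W (h : hom Z W) (g : hom Y Z) (f : hom X Y),
    compose h (compose g f) = compose (compose h g) f
}.
Arguments idm {c} X.
Arguments compose {c X Y Z} g f.

Definition is_iso (C : category) (X Y : C) (f : hom X Y) : Prop :=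
  exists g : hom Y X, compose g f = idm X /\ compose f g = idm Y.

Definition isomorphic (C : category) (X Y : C) : Prop :=
  exists f : hom X Y, is_iso f.

Definition opposite (C : category) : category :=
  @Category C (fun X Y => hom Y X) (fun X => idm X)
    (fun X Y Z (g : hom Z Y) (f : hom Y X) => compose f g)
    (fun X Y f => composem1 f) (fun X Y f => compose1m f)
    (fun X Y Z W h g f => esym (composeA f g h)).

Record functor (C D : category) := Functor {
  functor_obj :> C -> D;
  functor_map : forall X Y : C, hom X Y -> hom (functor_obj X) (functor_obj Y);
  functor_map1 : forall X : C, functor_map (idm X) = idm (functor_obj X);
  functor_mapM : forall (X Y Z : C) (g : hom Y Z) (f : hom X Y),
    functor_map (compose g f) = compose (functor_map g) (functor_map f)
}.
Arguments functor_map {C D} F [X Y] f : rename.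

(** [adjunction F G] is the data exhibiting [F] as left adjoint to [G]. *)
Record adjunction (C D : category) (F : functor C D) (G : functor D C) :=
  Adjunction {
  adj_unit : forall X : C, hom X (G (F X));
  adj_counit : forall Y : D, hom (F (G Y)) Y;
  unit_natural : forall (X X' : C) (f : hom X X'),
    compose (adj_unit X') f = compose (functor_map G (functor_map F f)) (adj_unit X);
  counit_natural : forall (Y Y' : D) (g : hom Y Y'),
    compose (adj_counit Y') (functor_map F (functor_map G g)) = compose g (adj_counit Y);
  triangle_left : forall X : C,
    compose (adj_counit (F X)) (functor_map F (adj_unit X)) = idm (F X);
  triangle_right : forall Y : D,
    compose (functor_map G (adj_counit Y)) (adj_unit (G Y)) = idm (G Y)
}.
Arguments adj_unit {C D F G} a X.
Arguments adj_counit {C D F G} a Y.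

Definition is_adjoint_equivalence (C D : category) (F : functor C D)
    (G : functor D C) (A : adjunction F G) : Prop :=
  (forall X : C, is_iso (adj_unit A X)) /\ (forall Y : D, is_iso (adj_counit A Y)).

Definition full_subcategory (C : category) (P : C -> Prop) : category :=
  @Category {X : C | P X} (fun X Y => hom (sval X) (sval Y))
    (fun X => idm (sval X)) (fun X Y Z g f => compose g f)
    (fun X Y f => compose1m f) (fun X Y f => composem1 f)
    (fun X Y Z W h g f => composeA h g f).

Definition restrict_functor (C D : category) (F : functor C D)
    (P : C -> Prop) (Q : D -> Prop) (FP : forall X, P X -> Q (F X)) :
    functor (full_subcategory P) (full_subcategory Q) :=
  @Functor (full_subcategory P) (full_subcategory Q)
    (fun X => exist Q (F (sval X)) (FP (sval X) (svalP X)))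
    (fun X Y f => functor_map F f)
    (fun X => functor_map1 F (sval X))
    (fun X Y Z g f => functor_mapM F g f).

Definition restrict_adjunction (C D : category) (F : functor C D)
    (G : functor D C) (A : adjunction F G) (P : C -> Prop) (Q : D -> Prop)
    (FP : forall X, P X -> Q (F X)) (GQ : forall Y, Q Y -> P (G Y)) :
    adjunction (restrict_functor FP) (restrict_functor GQ) :=
  @Adjunction (full_subcategory P) (full_subcategory Q)
    (restrict_functor FP) (restrict_functor GQ)
    (fun X => adj_unit A (sval X)) (fun Y => adj_counit A (sval Y))
    (fun X X' f => unit_natural A f) (fun Y Y' g => counit_natural A g)
    (fun X => triangle_left A (sval X)) (fun Y => triangle_right A (sval Y)).

Definition restricts_to_adjoint_equivalence (C D : category) (F : functor C D)
    (G : functor D C) (A : adjunction F G) (P : C -> Prop) (Q : D -> Prop) :=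
  exists (FP : forall X, P X -> Q (F X)) (GQ : forall Y, Q Y -> P (G Y)),
    is_adjoint_equivalence (restrict_adjunction A FP GQ).

HB.mixin Record isFrame (d : Order.disp_t) (T : Type)
    & Order.TBLattice d T := {
  bigjoin : set T -> T;
  bigjoin_ub : forall (V : set T) (v : T), V v -> (v <= bigjoin V)%O;
  bigjoin_lub : forall (V : set T) (w : T),
    (forall v, V v -> (v <= w)%O) -> (bigjoin V <= w)%O;
  meet_bigjoin : forall (u : T) (V : set T),
    Order.meet u (bigjoin V) = bigjoin [set Order.meet u v | v in V]
}.

#[short(type="frameType")]
HB.structure Definition Frame d := {T of Order.TBLattice d T & isFrame d T}.

Record frame_morphism d d' (L : frameType d) (M : frameType d') :=
  FrameMorphism {
  frame_fun :> L -> M;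
  frame_fun_bigjoin : forall V : set L,
    frame_fun (bigjoin V) = bigjoin (frame_fun @` V);
  frame_fun_top : frame_fun \top%O = \top%O;
  frame_fun_meet : forall u v : L,
    frame_fun (Order.meet u v) = Order.meet (frame_fun u) (frame_fun v)
}.

Lemma frame_morphismP d d' (L : frameType d) (M : frameType d')
  (f g : frame_morphism L M) : f =1 g -> f = g.
Proof.
case: f g => [f f1 f2 f3] [g g1 g2 g3] /= /funext fg.
by subst g; congr FrameMorphism; exact: Prop_irrelevance.
Qed.

Section frame_category.
Variable d : Order.disp_t.

Definition frame_id (L : frameType d) : frame_morphism L L.
Proof. by apply: (@FrameMorphism _ _ _ _ id) => // V; rewrite image_id. Defined.

Definition frame_comp (L M N : frameType d)
  (g : frame_morphism M N) (f : frame_morphism L M) : frame_morphism L N.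
Proof.
apply: (@FrameMorphism _ _ _ _ (g \o f)) => /=.
- by move=> V; rewrite !frame_fun_bigjoin image_comp.
- by rewrite !frame_fun_top.
- by move=> u v; rewrite !frame_fun_meet.
Defined.

Definition FrmD : category.
Proof.
by apply: (@Category (frameType d) (@frame_morphism d d) frame_id frame_comp);
  move=> *; exact: frame_morphismP.
Defined.

End frame_category.

(** Displays only steer notations; all objects of [Frm] share this one. *)
Fact frame_display : Order.disp_t. Proof. by []. Qed.

Definition Frm : category := FrmD frame_display.
Definition Loc : category := opposite Frm.

Section filters.
Context {d : Order.disp_t} {L : frameType d}.
Implicit Types F G D : set L.

Definition upclosed F : Prop := forall u v : L, F u -> (u <= v)%O -> F v.

Definition filtered F : Prop :=
  F !=set0 /\ forall u v, F u -> F v -> exists w, [/\ F w, (w <= u)%O & (w <= v)%O].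

Definition directed D : Prop :=
  D !=set0 /\ forall u v, D u -> D v -> exists w, [/\ D w, (u <= w)%O & (v <= w)%O].

(** A filter need not be proper: the whole frame is one. *)
Definition frame_filter F : Prop := upclosed F /\ filtered F.

Definition filter_join F G : set L :=
  [set Order.meet u v | u in F & v in G].

Definition completely_prime_filter F : Prop :=
  frame_filter F /\ forall V : set L, F (bigjoin V) -> exists2 v, V v & F v.

Definition scott_open F : Prop :=
  upclosed F /\
  forall D, directed D -> F (bigjoin D) -> exists2 u, D u & F u.

End filters.

Definition locally_temperate d (L : frameType d) : Prop :=
  forall F G : set L, frame_filter F -> scott_open F ->
    frame_filter G -> scott_open G -> scott_open (filter_join F G).

Definition temperate d (L : frameType d) : Prop :=
  locally_temperate L /\ scott_open [set \top%O : L].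

Section sober.
Variable X : topologicalType.

Definition ultrafilter_lim (U : set_system X) : set X :=
  [set x | forall A, open_nbhs x A -> U A].

Definition locally_strongly_sober : Prop :=
  forall U : set_system X, UltraFilter U ->
    ultrafilter_lim U = set0 \/
    exists! x : X, ultrafilter_lim U = closure [set x].

Definition strongly_sober : Prop :=
  forall U : set_system X, UltraFilter U ->
    exists! x : X, ultrafilter_lim U = closure [set x].

End sober.

(** A [topologicalType] may be empty; the choice structure it carries is
    invisible to the morphisms. *)
Definition Top : category.
Proof.
by apply: (@Category topologicalType (fun X Y => continuousType X Y)
  (fun X => (@idfun X : continuousType X X))
  (fun X Y Z (g : continuousType Y Z) (f : continuousType X Y) =>
     (g \o f : continuousType X Z)));
  move=> *; exact/continuousEP.
Defined.

Record opens (X : topologicalType) := Opens {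
  oset :> set X;
  oset_open : open oset
}.

Section opens_frame.
Variable X : topologicalType.
Implicit Types U V W : opens X.

Lemma opensP U V : oset U = oset V -> U = V.
Proof.
case: U V => [U oU] [V oV] /= UV; subst V.
by congr Opens; exact: Prop_irrelevance.
Qed.

HB.instance Definition _ := gen_eqMixin (opens X).
HB.instance Definition _ := gen_choiceMixin (opens X).

Definition opens_le : rel (opens X) := fun U V => `[< oset U `<=` oset V >].

Lemma opens_le_refl : reflexive opens_le.
Proof. by move=> U; apply/asboolP. Qed.

Lemma opens_le_anti : antisymmetric opens_le.
Proof.
by move=> U V /andP[/asboolP UV /asboolP VU]; apply: opensP; exact/seteqP.
Qed.

Lemma opens_le_trans : transitive opens_le.
Proof.
move=> V U W /asboolP UV /asboolP VW; apply/asboolP.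
exact: subset_trans VW.
Qed.

HB.instance Definition _ := Order.Le_isPOrder.Build frame_display (opens X)
  opens_le_refl opens_le_anti opens_le_trans.

Lemma opens_leP U V : reflect (oset U `<=` oset V) (U <= V)%O.
Proof. exact: asboolP. Qed.

Definition opens_meet U V : opens X :=
  Opens (openI (oset_open U) (oset_open V)).
Definition opens_join U V : opens X :=
  Opens (openU (oset_open U) (oset_open V)).
Definition opens_bigjoin (S : set (opens X)) : opens X :=
  Opens (@bigcup_open X _ S (@oset X) (fun U _ => oset_open U)).

Lemma opens_meetP U V W :
  (U <= opens_meet V W)%O = (U <= V)%O && (U <= W)%O.
Proof.
apply/opens_leP/andP; first by rewrite subsetI => -[? ?]; split; apply/opens_leP.
by move=> [/opens_leP ? /opens_leP ?]; rewrite subsetI.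
Qed.

Lemma opens_joinP U V W :
  (opens_join U V <= W)%O = (U <= W)%O && (V <= W)%O.
Proof.
apply/opens_leP/andP; first by rewrite subUset => -[? ?]; split; apply/opens_leP.
by move=> [/opens_leP ? /opens_leP ?]; rewrite subUset.
Qed.

HB.instance Definition _ :=
  Order.POrder_MeetJoin_isLattice.Build frame_display (opens X)
    opens_meetP opens_joinP.

Lemma opens_le0x U : (Opens open0 <= U)%O.
Proof. by apply/opens_leP; exact: sub0set. Qed.

Lemma opens_lex1 U : (U <= Opens openT)%O.
Proof. by apply/opens_leP; exact: subsetT. Qed.

HB.instance Definition _ :=
  Order.hasBottom.Build frame_display (opens X) opens_le0x.
HB.instance Definition _ :=
  Order.hasTop.Build frame_display (opens X) opens_lex1.

Lemma opens_bigjoin_ub (S : set (opens X)) U : S U -> (U <= opens_bigjoin S)%O.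
Proof. by move=> SU; apply/opens_leP => x Ux; exists U. Qed.

Lemma opens_bigjoin_lub (S : set (opens X)) W :
  (forall U, S U -> (U <= W)%O) -> (opens_bigjoin S <= W)%O.
Proof.
by move=> SW; apply/opens_leP => x [U SU Ux]; have /opens_leP := SW U SU; apply.
Qed.

Lemma opens_meet_bigjoin U (S : set (opens X)) :
  Order.meet U (opens_bigjoin S) = opens_bigjoin [set Order.meet U V | V in S].
Proof.
apply: opensP; apply/seteqP; split => x /=.
- by move=> [Ux [V SV Vx]]; exists (Order.meet U V); [exists V|split].
- by move=> [_ [V SV <-] [Ux Vx]]; split => //; exists V.
Qed.

HB.instance Definition _ := isFrame.Build frame_display (opens X)
  opens_bigjoin_ub opens_bigjoin_lub opens_meet_bigjoin.

End opens_frame.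

Definition opens_preimage (X Y : topologicalType) (f : continuousType X Y)
    (V : opens Y) : opens X :=
  @Opens X (f @^-1` oset V)
    ((continuousP f).1 (@cts_fun X Y f) (oset V) (oset_open V)).

Definition opens_map (X Y : topologicalType) (f : continuousType X Y) :
  frame_morphism (opens Y) (opens X).
Proof.
apply: (@FrameMorphism _ _ _ _ (opens_preimage f)).
- move=> S; apply: opensP; apply/seteqP; split => x /=.
  + by move=> [V SV Vfx]; exists (opens_preimage f V) => //; exists V.
  + by move=> [_ [V SV <-] Vfx]; exists V.
- exact: opensP.
- by move=> U V; exact: opensP.
Defined.

Definition OpenSets : functor Top Loc.
Proof.
apply: (@Functor Top Loc (fun X => opens X : frameType frame_display)
  (fun X Y f => opens_map f)).
- by move=> X; apply: frame_morphismP => U; exact: opensP.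
- by move=> X Y Z g f; apply: frame_morphismP => U; exact: opensP.
Defined.

Definition spatial (L : frameType frame_display) : Prop :=
  exists X : topologicalType, @isomorphic Frm L (opens X).

Record spec d (L : frameType d) := Spectrum {
  spec_set :> set L;
  spec_cprime : completely_prime_filter spec_set
}.

Section spectrum_topology.
Context {d : Order.disp_t} {L : frameType d}.
Implicit Types (x y : spec L) (u v : L).

Lemma specP x y : spec_set x = spec_set y -> x = y.
Proof.
case: x y => [x px] [y py] /= xy; subst y.
by congr Spectrum; exact: Prop_irrelevance.
Qed.

Lemma spec_top x : spec_set x \top%O.
Proof.
have [[up [[u xu] _]] _] := spec_cprime x.
exact: up (lex1 u).
Qed.

Lemma spec_meet x u v :
  spec_set x (Order.meet u v) <-> spec_set x u /\ spec_set x v.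
Proof.
have [[up [_ fi]] _] := spec_cprime x; split=> [xuv|[xu xv]].
  by split; apply: up xuv _; rewrite ?leIl ?leIr.
have [w [xw wu wv]] := fi _ _ xu xv.
by apply: up xw _; rewrite lexI wu wv.
Qed.

Lemma spec_bigjoin x (V : set L) :
  spec_set x (bigjoin V) <-> exists2 v, V v & spec_set x v.
Proof.
have [[up _] cp] := spec_cprime x; split; first exact: cp.
by move=> [v Vv xv]; apply: up xv _; exact: bigjoin_ub.
Qed.

Definition spec_basic u : set (spec L) := [set x | spec_set x u].

Definition spec_open : set_system (spec L) := range spec_basic.

Lemma spec_openT : spec_open setT.
Proof.
by exists \top%O => //; apply/seteqP; split => // x _; exact: spec_top.
Qed.

Lemma spec_openI : setI_closed spec_open.
Proof.
move=> _ _ [u _ <-] [v _ <-]; exists (Order.meet u v) => //.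
by apply/seteqP; split => x /spec_meet.
Qed.

Lemma spec_open_bigU (I : Type) (f : I -> set (spec L)) :
  (forall i, spec_open (f i)) -> spec_open (\bigcup_i f i).
Proof.
move=> fo; exists (bigjoin [set u | exists i, f i = spec_basic u]) => //.
apply/seteqP; split => x.
- by move=> /spec_bigjoin[u [i fi] xu]; exists i => //; rewrite fi.
- move=> [i _ fix_]; have [u _ fu] := fo i; apply/spec_bigjoin.
  by exists u; [exists i|move: fix_; rewrite -fu].
Qed.

HB.instance Definition _ := gen_eqMixin (spec L).
HB.instance Definition _ := gen_choiceMixin (spec L).
HB.instance Definition _ := isOpenTopological.Build (spec L)
  spec_openT spec_openI spec_open_bigU.

Lemma spec_openE : (open : set_system (spec L)) = range spec_basic.
Proof. by []. Qed.

Lemma open_spec_basic u : open (spec_basic u).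
Proof. by exists u. Qed.

End spectrum_topology.

Section spectrum_map.
Context {d : Order.disp_t} {L M : frameType d} (phi : frame_morphism L M).

Lemma preimage_cprime (y : spec M) :
  completely_prime_filter (phi @^-1` spec_set y).
Proof.
have phi_le u v : (u <= v)%O -> (phi u <= phi v)%O.
  by move=> /meet_idPl uv; rewrite -uv frame_fun_meet leIr.
have [[up _] _] := spec_cprime y.
split; first split.
- by move=> u v /= yu /phi_le; exact: up.
- split; first by exists \top%O; rewrite /= frame_fun_top; exact: spec_top.
  move=> u v yu yv; exists (Order.meet u v).
  split; [|exact: leIl|exact: leIr].
  by rewrite /= frame_fun_meet; apply/spec_meet.
- by move=> V; rewrite /= frame_fun_bigjoin => /spec_bigjoin[_ [v Vv <-] yv]; exists v.
Qed.

Definition spec_preimage (y : spec M) : spec L := Spectrum (preimage_cprime y).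

Lemma spec_preimage_continuous : continuous spec_preimage.
Proof.
by apply/continuousP => _ [u _ <-]; exact: (open_spec_basic (phi u)).
Qed.

Definition spec_map : continuousType (spec M) (spec L) :=
  mkcts spec_preimage_continuous.

End spectrum_map.

Definition Spec : functor Loc Top.
Proof.
apply: (@Functor Loc Top
  (fun L : frameType frame_display => spec L : topologicalType)
  (fun L M phi => spec_map phi)).
- by move=> L; apply/continuousEP => x; exact: specP.
- by move=> L M N g f; apply/continuousEP => x; exact: specP.
Defined.

Section unit_counit.

Lemma nbhs_cprime (X : topologicalType) (x : X) :
  completely_prime_filter [set U : opens X | oset U x].
Proof.
split; first split.
- by move=> U V /= Ux /opens_leP; apply.
- split; first by exists \top%O.
  move=> U V Ux Vx; exists (Order.meet U V).
  by split; [split|exact: leIl|exact: leIr].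
- by move=> S [U SU Ux]; exists U.
Qed.

Definition nbhs_point (X : topologicalType) (x : X) : spec (opens X) :=
  Spectrum (nbhs_cprime x).

Lemma nbhs_point_continuous (X : topologicalType) : continuous (@nbhs_point X).
Proof. by apply/continuousP => _ [U _ <-]; exact: oset_open. Qed.

Definition spec_unit (X : topologicalType) :
  continuousType X (spec (opens X)) := mkcts (@nbhs_point_continuous X).

Definition spec_counit d (L : frameType d) :
  frame_morphism L (opens (spec L)).
Proof.
apply: (@FrameMorphism _ _ _ _ (fun u : L => Opens (open_spec_basic u))).
- move=> V; apply: opensP; apply/seteqP; split => x /=.
  + move=> /spec_bigjoin[v Vv xv].
    by exists (Opens (open_spec_basic v)) => //; exists v.
  + by move=> [_ [v Vv <-] xv]; apply/spec_bigjoin; exists v.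
- by apply: opensP; apply/seteqP; split => // x _; exact: spec_top.
- by move=> u v; apply: opensP; apply/seteqP; split => x /spec_meet.
Defined.

End unit_counit.

(** The unit sends [x] to its filter of open neighbourhoods; the counit at [L]
    is the frame morphism sending [u] to the basic open set of [u]. *)
Definition OpenSets_Spec_adjunction : adjunction OpenSets Spec.
Proof.
apply: (@Adjunction Top Loc OpenSets Spec spec_unit
  (fun L : frameType frame_display => spec_counit L)).
- by move=> X Y f; apply/continuousEP => x; exact: specP.
- by move=> L M phi; apply: frame_morphismP => u; exact: opensP.
- by move=> X; apply: frame_morphismP => U; exact: opensP.
- by move=> L; apply/continuousEP => x; exact: specP.
Defined.

(* Main.v *)
(** The key observation is that if a Scott-open set [F]
    of opens is contained in an ultrafilter [U], [F] does not contain the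
    union of the opens that are not in [U], because those opens form a directed
    family.  That union is the complement of the limit set of [U].  Hence every
    open set in [F] meets the limit of [U]; when the limit is the closure of a
    point [x], this point lies in every member of [F].  Applied to two
    Scott-open filters at once, this shows that their join is Scott-open.
    Conversely, in [Spec L] two limits [x], [y] of [U] are Scott-open filters of
    [L] and the same observation for their join shows that the limit set is
    irreducible, hence the closure of a point. *)
Require Import Defs.
From mathcomp Require Import all_boot all_order.
From mathcomp Require Import boolp classical_sets filter topology_structure.

Set Implicit Arguments.
Unset Strict Implicit.
Unset Printing Implicit Defensive.
Import Order.TTheory.
Local Open Scope classical_set_scope.

(** * Closures of points and limits of ultrafilters *)

Lemma closure1P (X : topologicalType) (x y : X) :
  closure [set x] y <-> forall A, open A -> A y -> A x.
Proof.
split=> [xy A oA Ay|xy B].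
  by have [_ [-> //]] := xy _ (open_nbhs_nbhs (conj oA Ay)).
rewrite nbhsE => -[A [oA Ay] AB].
by exists x; split => //; apply: AB; exact: xy.
Qed.

Lemma ultra_setU (T : Type) (U : set_system T) (A B : set T) :
  UltraFilter U -> U (A `|` B) -> U A \/ U B.
Proof.
move=> UU UAB; have [|UCA] := in_ultra_setVsetC A UU; first by left.
right; apply: filterS (filterI UAB UCA).
by move=> x [[]].
Qed.

Lemma lim_closed_point (X : topologicalType) (U : set_system X) (x : X)
  (A : set X) : UltraFilter U -> ultrafilter_lim U x -> closed A -> U A -> A x.
Proof.
move=> UU limx cA UA; apply: contrapT => nAx.
have UCA : U (~` A) by apply: limx; split => //; exact: closed_openC.
by have [z []] := filter_ex (filterI UA UCA).
Qed.

(** * Frame morphisms, joins of filters and Scott-open sets *)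

Section frames.
Context {d : Order.disp_t}.

Lemma frame_fun_le d' (L : frameType d) (M : frameType d')
  (phi : frame_morphism L M) (u v : L) : (u <= v)%O -> (phi u <= phi v)%O.
Proof. by move=> /meet_idPl uv; rewrite -uv frame_fun_meet leIr. Qed.

Lemma bijective_frame_morphism_iso (L M : FrmD d) (phi : hom L M) :
  injective phi -> (forall v, exists u, phi u = v) -> is_iso phi.
Proof.
move=> phi_inj /choice[g phigK].
have gphiK : cancel phi g by move=> u; apply: phi_inj; rewrite phigK.
have g_bigjoin V : g (bigjoin V) = bigjoin (g @` V).
  apply: phi_inj; rewrite phigK frame_fun_bigjoin image_comp.
  by rewrite (eq_imagel (fun v _ => phigK v)) image_id.
have g_top : g \top%O = \top%O.
  by apply: phi_inj; rewrite phigK frame_fun_top.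
have g_meet u v : g (Order.meet u v) = Order.meet (g u) (g v).
  by apply: phi_inj; rewrite frame_fun_meet !phigK.
exists (FrameMorphism g_bigjoin g_top g_meet).
by split; apply: frame_morphismP => u /=.
Qed.

Lemma cprime_scott_open (L : frameType d) (F : set L) :
  completely_prime_filter F -> scott_open F.
Proof. by move=> [[up _] cp]; split => // D _; exact: cp. Qed.

Lemma filter_join_frame_filter (L : frameType d) (F G : set L) :
  frame_filter F -> frame_filter G ->
  [/\ F `<=` filter_join F G, G `<=` filter_join F G
    & filtered (filter_join F G)].
Proof.
move=> [upF [[f Ff] fiF]] [upG [[g Gg] fiG]].
have FT : F \top%O by exact: upF Ff (lex1 f).
have GT : G \top%O by exact: upG Gg (lex1 g).
split.
- by move=> u Fu; exists u => //; exists \top%O => //; rewrite meetx1.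
- by move=> v Gv; exists \top%O => //; exists v => //; rewrite meet1x.
- split; first by exists (Order.meet f g), f => //; exists g.
  move=> _ _ [u Fu [v Gv <-]] [u' Fu' [v' Gv' <-]].
  have [u1 [Fu1 u1u u1u']] := fiF _ _ Fu Fu'.
  have [v1 [Gv1 v1v v1v']] := fiG _ _ Gv Gv'.
  exists (Order.meet u1 v1); split; first by exists u1 => //; exists v1.
  + exact: leI2.
  + exact: leI2.
Qed.

(** A general [phi] covers two uses: the identity of [opens X] and the counit into the opens of the
    spectrum. *)
Lemma ultra_scott_open (L : frameType d) (X : topologicalType)
  (phi : frame_morphism L (opens X)) (U : set_system X) (F : set L) :
  UltraFilter U -> scott_open F -> (forall u, F u -> U (oset (phi u))) ->
  ~ F (bigjoin [set w | ~ U (oset (phi w))]).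
Proof.
move=> UU [_ Fso] FU /Fso[]; last by move=> w nUw /FU.
(* Bottom and binary joins are written with [bigjoin], the joins that a frame morphism preserves by
   definition. *)
split.
  exists (bigjoin set0) => /=; rewrite frame_fun_bigjoin image_set0 => U0.
  by have [x [V []]] := filter_ex U0.
move=> u v nUu nUv; exists (bigjoin [set u; v]).
split; [|by apply: bigjoin_ub; left|by apply: bigjoin_ub; right].
rewrite /= frame_fun_bigjoin => Uuv.
suff /(ultra_setU UU)[//|//] : U (oset (phi u) `|` oset (phi v)).
apply: filterS Uuv => x /= [_ [w [->|->] <-]]; by [left|right].
Qed.

End frames.

(** * Sobriety of locally strongly sober spaces *)

Section sober_spaces.
Variable X : topologicalType.
Hypothesis lssX : locally_strongly_sober X.

Lemma lss_lim (U : set_system X) : UltraFilter U ->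
  ultrafilter_lim U !=set0 -> exists! x : X, ultrafilter_lim U = closure [set x].
Proof. by move=> /lssX[-> [x []]|]. Qed.

Lemma lss_cprime (Phi : spec (opens X)) : exists! x : X, nbhs_point x = Phi.
Proof.
(* By complete primeness, the union removed here is the largest open set outside [Phi]. *)
pose C := ~` oset (bigjoin [set W | ~ spec_set Phi W]).
have CE (W : opens X) : spec_set Phi W <-> oset W `&` C !=set0.
  split=> [PW|[x [Wx Cx]]]; last first.
    by apply: contrapT => nPW; apply: Cx; exists W.
  apply: contrapT => WC.
  suff /spec_bigjoin[V] : spec_set Phi (bigjoin [set W | ~ spec_set Phi W]).
    by [].
  have [[up _] _] := spec_cprime Phi; apply: up PW _; apply/opens_leP => x Wx.
  by apply: contrapT => Cx; apply: WC; exists x.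
(* The traces on [C] of the opens in [Phi] generate a proper filter; an ultrafilter above it has
   exactly [C] as limit set, so [C] has a generic point. *)
pose B (W : opens X) := oset W `&` C.
have Bf : ProperFilter (filter_from [set W | spec_set Phi W] B).
  apply: filter_from_proper => [|W PW]; last exact/CE.
  apply: filter_from_filter; first by exists \top%O; exact: spec_top.
  move=> V W PV PW; exists (Order.meet V W); first by apply/spec_meet.
  by move=> x [[Vx Wx] Cx].
have [U [UU BU]] := ultraFilterLemma Bf.
have UPhi (W : opens X) : spec_set Phi W -> U (oset W).
  by move=> PW; apply: BU; exists W => // x [].
have UC : U C by apply: BU; exists \top%O => [|x []//]; exact: spec_top.
have cC : closed C by apply: open_closedC; exact: oset_open.
have limE : ultrafilter_lim U = C.
  apply/seteqP; split=> x; first by move=> limx; exact: lim_closed_point UC.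
  by move=> Cx A [oA Ax]; apply: (UPhi (Opens oA)); apply/CE; exists x.
have [y [_ Cy]] := (CE \top%O).1 (spec_top Phi).
have lim0 : ultrafilter_lim U !=set0 by exists y; rewrite limE.
have [x [limx x_uniq]] := lss_lim UU lim0.
have Cx : C x by rewrite -limE limx; apply/closure1P.
exists x; split.
  apply: specP; apply/seteqP; split=> W /= => [Wx|].
    by apply/CE; exists x.
  move=> /CE[z [Wz]]; rewrite -limE limx => /closure1P; apply => //.
  exact: oset_open.
(* Any [x'] with neighbourhood filter [Phi] also has closure [C]. *)
move=> x' x'Phi; apply: x_uniq; rewrite limE; apply/seteqP; split => z.
  move=> Cz; apply/closure1P => A oA Az.
  by change (spec_set (nbhs_point x') (Opens oA)); rewrite x'Phi CE; exists z.
move=> /closure1P x'z; apply: contrapT => nCz.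
have : (~` C) x' by apply: x'z => //; exact: closed_openC.
rewrite setCK => -[W nPW]; apply: contra_not nPW.
by rewrite -x'Phi.
Qed.

Lemma lss_unit_iso : @is_iso Top X (spec (opens X)) (spec_unit X).
Proof.
have /choice[g gP] := lss_cprime.
have gK Phi : nbhs_point (g Phi) = Phi by have [] := gP Phi.
have g_cts : continuous g.
  (* The preimage of [A] under [g] is the basic open set of [A], because [Phi] is the neighbourhood
     filter of [g Phi]. *)
  apply/continuousP => A oA; exists (Opens oA) => //.
  apply/seteqP; split => Phi.
    by rewrite -[X in spec_basic _ X]gK.
  by rewrite -[X in _ -> spec_basic _ X]gK.
exists (mkcts g_cts : continuousType _ _); split; apply/continuousEP => z /=.
  by have [_] := gP (nbhs_point z); apply.
exact: gK.
Qed.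

End sober_spaces.

(** * Temperateness of the frame of opens *)

(** An open set missing [x] misses its closure, hence lies in the union of the opens outside [U],
    which [F] cannot contain. *)
Lemma scott_open_lim_point (X : topologicalType) (U : set_system X) (F : set (opens X)) (x : X) :
  UltraFilter U -> ultrafilter_lim U = closure [set x] ->
  scott_open F -> (forall V, F V -> U (oset V)) -> forall V, F V -> oset V x.
Proof.
move=> UU limx Fso FU V FV.
have := ultra_scott_open (phi := frame_id (opens X)) UU Fso FU.
apply: contra_notP => nVx; have [up _] := Fso; apply: up FV _.
apply/opens_leP => z Vz; apply: contrapT => nz.
have : ultrafilter_lim U z.
  move=> A [oA Az]; apply: contrapT => nUA; apply: nz.
  by exists (Opens oA).
by rewrite limx => /closure1P/(_ _ (oset_open V) Vz).
Qed.

(** Without limit points, the opens outside [U] would cover the space. *)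
Lemma scott_open_lim (X : topologicalType) (U : set_system X) (F : set (opens X)) :
  UltraFilter U -> scott_open F -> F \top%O ->
  (forall V, F V -> U (oset V)) -> ultrafilter_lim U !=set0.
Proof.
move=> UU Fso FT FU.
have := ultra_scott_open (phi := frame_id (opens X)) UU Fso FU.
apply: contra_notP => lim0; have [up _] := Fso; apply: up FT _.
apply/opens_leP => z _; apply: contrapT => nz; apply: lim0; exists z.
by move=> A [oA Az]; apply: contrapT => nUA; apply: nz; exists (Opens oA).
Qed.

(** The differences of a member of [F] and a member of [D] generate a proper filter. An ultrafilter
    above it contains the complement of each [W] in [D], so [W] is no neighbourhood of a limit. *)
Lemma ultra_avoid_directed (X : topologicalType) (F D : set (opens X)) :
  filtered F -> directed D ->
  (forall V W, F V -> D W -> ~ oset V `<=` oset W) ->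
  exists2 U : set_system X, UltraFilter U &
    (forall V, F V -> U (oset V)) /\
    forall W x, D W -> ultrafilter_lim U x -> ~ oset W x.
Proof.
move=> [[V0 FV0] fiF] [[W0 DW0] dD] FD.
pose B (VW : opens X * opens X) := oset VW.1 `\` oset VW.2.
have Bf : ProperFilter (filter_from (F `*` D) B).
  apply: filter_from_proper => [|[V W] [/= FV DW]]; last first.
    apply: contrapT => B0; apply: (FD V W) => // x Vx.
    by apply: contrapT => nWx; apply: B0; exists x.
  apply: filter_from_filter; first by exists (V0, W0).
  move=> [V W] [V' W'] [/= FV DW] [/= FV' DW'].
  have [V1 [FV1 /opens_leP V1V /opens_leP V1V']] := fiF _ _ FV FV'.
  have [W1 [DW1 /opens_leP WW1 /opens_leP W'W1]] := dD _ _ DW DW'.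
  exists (V1, W1) => // x [/= V1x nW1x].
  by split; split => /=; [exact: V1V|move=> /WW1|exact: V1V'|move=> /W'W1].
have [U [UU BU]] := ultraFilterLemma Bf.
exists U => //; split=> [V FV|W x DW limx Wx].
  by apply: BU; exists (V, W0) => // x [].
have UW : U (oset W) by apply: limx; split => //; exact: oset_open.
have UCW : U (~` oset W) by apply: BU; exists (V0, W) => // z [].
by have [z []] := filter_ex (filterI UW UCW).
Qed.

Lemma lss_locally_temperate (X : topologicalType) :
  locally_strongly_sober X -> locally_temperate (opens X).
Proof.
move=> lssX F G fF Fso fG Gso.
have [FFG GFG fiFG] := filter_join_frame_filter fF fG.
have FT : F \top%O by have [up [[u Fu] _]] := fF; exact: up Fu (lex1 u).
have upFG : upclosed (filter_join F G).
  move=> _ W [V FV [V' GV' <-]] /opens_leP VW.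
  (* Distributivity: the meet of [V] joined with [W] and [V'] joined with [W] is the meet of [V] and
     [V'] joined with [W], that is [W]. *)
  exists (Order.join V W); first by have [up _] := fF; exact: up FV (leUl _ _).
  exists (Order.join V' W); first by have [up _] := fG; exact: up GV' (leUl _ _).
  apply: opensP; apply/seteqP; split => x /=; last by move=> Wx; split; right.
  by move=> [[Vx|//] [V'x|//]]; exact: VW.
split => // D dD [V FV [V' GV' VW]]; apply: contrapT => FGD.
(* If [D] avoids the join, no limit of [U] lies in a member of [D]. Yet the generic point of the
   limit set lies in [V] and [V'], hence in the union of [D]. *)
have [||U UU [FGU limD]] := @ultra_avoid_directed _ (filter_join F G) D _ dD.
- exact: fiFG.
- move=> W W' FGW DW' /opens_leP WW'; apply: FGD; exists W' => //.
  exact: upFG FGW WW'.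
have FU W : F W -> U (oset W) by move=> /FFG/FGU.
have GU W : G W -> U (oset W) by move=> /GFG/FGU.
have [x [limx _]] := lss_lim lssX UU (scott_open_lim UU Fso FT FU).
have Vx := scott_open_lim_point UU limx Fso FU FV.
have V'x := scott_open_lim_point UU limx Gso GU GV'.
have : oset (bigjoin D) x by rewrite -VW.
move=> [W DW]; apply: limD DW _; rewrite limx; exact/closure1P.
Qed.

Lemma strongly_sober_lss (X : topologicalType) :
  strongly_sober X -> locally_strongly_sober X.
Proof. by move=> ssX U /ssX; right. Qed.

Lemma strongly_sober_temperate (X : topologicalType) :
  strongly_sober X -> temperate (opens X).
Proof.
move=> ssX; split; first exact: lss_locally_temperate (strongly_sober_lss ssX).
split=> [u v -> | D dD DT]; first by rewrite le1x => /eqP.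
apply: contrapT => nDT.
(* The filter reduced to the whole space suffices here: strong sobriety itself provides a limit,
   which [D] would have to cover. *)
have [||U UU [_ limD]] := @ultra_avoid_directed _ [set \top%O] D _ dD.
- split; first by exists \top%O.
  by move=> _ _ -> ->; exists \top%O.
- move=> _ W -> DW TW; apply: nDT; exists W => //=.
  by apply/eqP; rewrite -le1x; apply/opens_leP.
have [x [limx _]] := ssX _ UU.
have : oset (bigjoin D) x by rewrite DT.
move=> [W DW]; apply: limD DW _; rewrite limx; exact/closure1P.
Qed.

(** * Sobriety properties of the spectrum of a spatial frame *)

Section spatial_frames.
Variable L : frameType frame_display.

Lemma spatial_opens (X : topologicalType) : spatial (opens X).
Proof.
exists X, (@idm Frm (opens X)); exists (@idm Frm (opens X)).
by split; exact: compose1m.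
Qed.

(** The points pulled back from a space representing [L] already detect the order. *)
Lemma spatial_separated (u v : L) : spatial L ->
  (forall x : spec L, spec_set x u -> spec_set x v) -> (u <= v)%O.
Proof.
move=> [X [phi [psi [psiphi _]]]] uv.
have phiK w : psi (phi w) = w.
  exact: (congr1 (fun f : frame_morphism L L => f w) psiphi).
rewrite -(phiK u) -(phiK v); apply: frame_fun_le; apply/opens_leP => x ux.
exact: (uv (spec_preimage phi (nbhs_point x))).
Qed.

(** Separation by points gives injectivity; surjectivity holds since every open set of the spectrum
    is basic. *)
Lemma spatial_counit_iso : spatial L ->
  @is_iso Loc (opens (spec L)) L (spec_counit L).
Proof.
move=> sL.
have [||psi [psiphi phipsi]] :=
  @bijective_frame_morphism_iso _ L (opens (spec L)) (spec_counit L).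
- move=> u v /(congr1 (@oset _)) /= uv; apply/le_anti/andP.
  split; apply: spatial_separated => // x.
    by change (spec_basic u x -> spec_basic v x); rewrite uv.
  by change (spec_basic v x -> spec_basic u x); rewrite uv.
- move=> [W oW]; have [u _ uW] := oW.
  by exists u; apply: opensP.
by exists psi.
Qed.

(** Otherwise every point containing [u] contains the join of the elements whose basic open set is
    outside [U]; by spatiality [u] is below this join, which [F] cannot contain. *)
Lemma spec_lim_scott (U : set_system (spec L)) (F : set L) (u : L) :
  spatial L -> UltraFilter U -> scott_open F ->
  (forall v, F v -> U (spec_basic v)) -> F u ->
  exists2 z : spec L, ultrafilter_lim U z & spec_set z u.
Proof.
move=> sL UU Fso FU Fu.
have := ultra_scott_open (phi := spec_counit L) UU Fso FU.
apply: contra_notP => nz; have [up _] := Fso; apply: up Fu _.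
apply: spatial_separated => // z zu; apply: contrapT => zw; apply: nz.
exists z => // _ [[w _ <-] zw']; apply: contrapT => nUw.
by apply: zw; apply/spec_bigjoin; exists w.
Qed.

Lemma spec_lim (U : set_system (spec L)) :
  locally_temperate L -> spatial L -> UltraFilter U ->
  ultrafilter_lim U !=set0 ->
  exists! x : spec L, ultrafilter_lim U = closure [set x].
Proof.
move=> ltL sL UU [x0 limx0].
(* The union of all limits, seen as filters; it will be the generic point of the limit set. *)
pose Phi : set L :=
  [set u | exists2 x, ultrafilter_lim U x & spec_set x u].
have Phi_cprime : completely_prime_filter Phi.
  split; [split; [|split]|].
  - move=> u v [x limx xu] uv; exists x => //.
    by have [[up _] _] := spec_cprime x; exact: up xu uv.
  - by exists \top%O, x0 => //; exact: spec_top.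
  - move=> u v [x limx xu] [y limy yv]; exists (Order.meet u v).
    split; [|exact: leIl|exact: leIr].
    have [fx _] := spec_cprime x; have [fy _] := spec_cprime y.
    (* The join of the two limits is Scott-open by local temperateness, and its elements have basic
       open sets in [U]; hence some limit contains the meet of [u] and [v]. *)
    apply: (@spec_lim_scott U (filter_join (spec_set x) (spec_set y))) => //.
    + by apply: ltL => //; exact: cprime_scott_open (spec_cprime _).
    + move=> _ [u' xu' [v' yv' <-]].
      have Uu' : U (spec_basic u').
        by apply: limx; split => //; exact: open_spec_basic.
      have Uv' : U (spec_basic v').
        by apply: limy; split => //; exact: open_spec_basic.
      by apply: filterS (filterI Uu' Uv') => z [zu' zv']; apply/spec_meet.
    + by exists u => //; exists v.
  - by move=> V [x limx /spec_bigjoin[v Vv xv]]; exists v => //; exists x.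
have limE : ultrafilter_lim U = closure [set Spectrum Phi_cprime].
  apply/seteqP; split=> z.
    by move=> limz; apply/closure1P => _ [u _ <-] zu; exists z.
  (* A neighbourhood of [z] contains [Phi], hence also an actual limit [x], and so belongs to
     [U]. *)
  move=> /closure1P zPhi A [oA Az].
  have [u _ uA] := oA; have [x limx xu] : Phi u.
    by change (spec_basic u (Spectrum Phi_cprime)); rewrite uA; exact: zPhi.
  by apply: limx; split => //; rewrite -uA.
(* Uniqueness is the T0 property: points with equal closures lie in the same basic open sets. *)
exists (Spectrum Phi_cprime); split => // y; rewrite limE => Phiy.
apply: specP; apply/seteqP; split => u ux.
- have : closure [set y] (Spectrum Phi_cprime).
    by rewrite -Phiy; exact/closure1P.
  by move=> /closure1P/(_ _ (open_spec_basic u)); apply.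
- have : closure [set Spectrum Phi_cprime] y.
    by rewrite Phiy; exact/closure1P.
  by move=> /closure1P/(_ _ (open_spec_basic u)); apply.
Qed.

Lemma spec_lss : locally_temperate L -> spatial L ->
  locally_strongly_sober (spec L).
Proof.
move=> ltL sL U UU; have [|/set0P/spec_lim] := eqVneq (ultrafilter_lim U) set0.
  by left.
by right; auto.
Qed.

Lemma spec_strongly_sober : temperate L -> spatial L -> strongly_sober (spec L).
Proof.
move=> [ltL Tso] sL U UU; apply: spec_lim => //.
(* Scott-openness of the filter reduced to the top element makes the limit set nonempty. *)
have [|//|z limz _] := @spec_lim_scott U _ \top%O sL UU Tso.
- by move=> _ ->; apply: filterS filterT => x _; exact: spec_top.
- by exists z.
Qed.

End spatial_frames.

(** * Assembling the two equivalences *)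

Theorem theorem5p4 :
  restricts_to_adjoint_equivalence OpenSets_Spec_adjunction
    (fun X : Top => locally_strongly_sober X)
    (fun L : Loc => locally_temperate L /\ spatial L) /\
  restricts_to_adjoint_equivalence OpenSets_Spec_adjunction
    (fun X : Top => strongly_sober X)
    (fun L : Loc => temperate L /\ spatial L).
Proof.
split.
- exists (fun X lssX => conj (lss_locally_temperate lssX) (spatial_opens X)).
  exists (fun L ltL => spec_lss ltL.1 ltL.2).
  split=> [[X lssX]|[L [ltL sL]]]; first exact: (lss_unit_iso lssX).
  exact: (spatial_counit_iso sL).
- exists (fun X ssX => conj (strongly_sober_temperate ssX) (spatial_opens X)).
  exists (fun L tL => spec_strongly_sober tL.1 tL.2).
  split=> [[X ssX]|[L [tL sL]]].
    exact: (lss_unit_iso (strongly_sober_lss ssX)).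
  exact: (spatial_counit_iso sL).
Qed.
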